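(* For any natural number $n\ge 1$ and any natural number $m\geq 1$, $$\sum_{x=1}^{m}x^{n}=(-1)^{n}\sum_{i=1}^{n}a_i\,m(m+1)(m+2)\cdots(m+i),$$ where $$a_i=\frac{1}{i+1}\sum_{k=1}^{i}\frac{(-1)^{k}k^{n}}{k!\,(i-k)!}\qquad (i=1,2,\ldots,n).$$
   Context: Natural numbers are the positive integers. *)

(* Defs.v *)
From mathcomp Require Import all_boot all_order all_algebra.

Set Implicit Arguments.
Unset Strict Implicit.
Unset Printing Implicit Defensive.

Import GRing.Theory.
Local Open Scope ring_scope.

Definition a (n i : nat) : rat :=
  1 / (i%:R + 1) *
  \sum_(1 <= k < i.+1) ((-1) ^+ k * k%:R ^+ n) / (k`!%:R * (i - k)`!%:R).

(* Main.v *)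
Require Import Defs.
From mathcomp Require Import all_boot all_order all_algebra.
From mathcomp Require Import ring.

Set Implicit Arguments.
Unset Strict Implicit.
Unset Printing Implicit Defensive.

Import GRing.Theory Num.Theory.
Local Open Scope ring_scope.

(** Write x^(i) for the rising factorial x (x + 1) ... (x + i - 1). Up to a
    sign, the inner sums of the formula are Stirling numbers of the second kind:
    c(n, i) = \sum_(k <= i) (-1)^k k^n / (k! (i - k)!) = (-1)^i S(n, i).
    Two facts give the theorem.

    - Powers expand in rising factorials: (- x)^n = \sum_(i <= n) c(n, i) x^(i)
      ([exprN_rising]). This is an induction on n. Multiplication by - x turns
      x^(i) into i x^(i) - x^(i+1), so the coefficients of the expansion satisfy
      c(n+1, i+1) = (i+1) c(n, i+1) - c(n, i); the closed form satisfies the same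
      recurrence because (i+1-k) / (i+1-k)! = 1 / (i-k)! ([stirling_recurrence]).
    The induction starts from c(0, i) = 0 for i > 0, which is the binomial
    formula for (1 - 1)^i ([stirling0]).

    - Rising factorials telescope: (i+1) \sum_(1 <= x <= m) x^(i) = m^(i+1)
      ([sum_rising]), as (x+1)^(i+1) - x^(i+1) = (i+1) (x+1)^(i).

    Summing the expansion over x and exchanging the two sums yields the formula,
    with a_i = c(n, i) / (i+1). The terms k = 0 and i = 0 disappear as n > 0. *)

Definition rising (R : pzRingType) (x : R) (i : nat) : R :=
  \prod_(0 <= j < i) (x + j%:R).

Definition signed_stirling (F : fieldType) (n i : nat) : F :=
  \sum_(0 <= k < i.+1) (-1) ^+ k * k%:R ^+ n / (k`!%:R * (i - k)`!%:R).
Arguments signed_stirling {F} n i.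

Lemma risingS (R : pzRingType) (x : R) (i : nat) :
  rising x i.+1 = rising x i * (x + i%:R).
Proof. by rewrite /rising big_nat_recr. Qed.

Lemma risingSl (R : pzRingType) (x : R) (i : nat) :
  rising x i.+1 = x * rising (x + 1) i.
Proof.
rewrite /rising big_nat_recl //= addr0; congr (_ * _).
by apply: eq_bigr => j _; rewrite -addrA -natr1 [1 + _]addrC.
Qed.

(** Peeling the last factor off the left-hand side and the first one off
    [rising x i.+1] leaves the common factor [rising (x + 1) i]. *)
Lemma rising_diff (R : comPzRingType) (x : R) (i : nat) :
  rising (x + 1) i.+1 - rising x i.+1 = i.+1%:R * rising (x + 1) i.
Proof. by rewrite risingS risingSl -natr1; ring. Qed.

Lemma sum_rising (R : comPzRingType) (m i : nat) :
  i.+1%:R * \sum_(1 <= x < m.+1) rising (x%:R : R) i = rising (m%:R : R) i.+1.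
Proof.
elim: m => [|m IHm]; first by rewrite big_geq // mulr0 risingSl mul0r.
by rewrite big_nat_recr //= mulrDr IHm -[in RHS]natr1 -[m.+1%:R]natr1
           -rising_diff; ring.
Qed.

Section SignedStirling.

Variable F : numFieldType.

Lemma fact_neq0 (k : nat) : k`!%:R != 0 :> F.
Proof. by rewrite pnatr_eq0 -lt0n fact_gt0. Qed.

(** Multiplied by [i.+1`!], this is the alternating sum of a row of binomial
    coefficients, that is, [(1 - 1) ^+ i.+1]. *)
Lemma stirling0 (i : nat) : signed_stirling 0 i.+1 = 0 :> F.
Proof.
apply: (mulfI (fact_neq0 i.+1)); rewrite mulr0 /signed_stirling mulr_sumr.
transitivity ((1 - 1) ^+ i.+1 : F); last by rewrite subrr expr0n.
rewrite exprBn big_mkord; apply: eq_bigr => k _.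
rewrite !expr1n !mulr1 -mulr_natr.
have le_ki : (k <= i.+1)%N by rewrite -ltnS.
have -> : i.+1`!%:R = 'C(i.+1, k)%:R * (k`!%:R * (i.+1 - k)`!%:R) :> F.
  by rewrite -!natrM bin_fact.
have := fact_neq0 k; have := fact_neq0 (i.+1 - k) => nz1 nz2.
by field; rewrite nz1 nz2.
Qed.

(** Write the extra factor k as (i+1) - (i+1-k); the second summand cancels
    against the factorial of i+1-k, and vanishes at k = i+1. *)
Lemma stirling_recurrence (n i : nat) :
  signed_stirling n.+1 i.+1 =
  i.+1%:R * signed_stirling n i.+1 - signed_stirling n i :> F.
Proof.
rewrite /signed_stirling mulr_sumr.
rewrite big_nat_recr //= [X in _ = X - _]big_nat_recr //=.
rewrite [RHS]addrAC -sumrB; congr (_ + _).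
  apply: eq_big_nat => k /andP[_ lt_ki].
  have le_ki : (k <= i)%N by [].
  rewrite (subSn le_ki) factS natrM.
  have -> : i.+1%:R = k%:R + (i - k).+1%:R :> F.
    by rewrite -natrD addnS subnKC.
  have nz1 := fact_neq0 k; have nz2 := fact_neq0 (i - k).
  have nz3 : (i - k).+1%:R != 0 :> F by rewrite pnatr_eq0.
  move: nz1 nz2 nz3; rewrite [_ ^+ n.+1]exprS.
  move: (k`!%:R) ((i - k)`!%:R) ((i - k).+1%:R) => u v w nz1 nz2 nz3.
  by field; rewrite nz1 nz2 nz3.
by rewrite [_ ^+ n.+1]exprS mulrCA -!mulrA.
Qed.

Lemma stirlingS0 (n : nat) : signed_stirling n.+1 0 = 0 :> F.
Proof. by rewrite /signed_stirling big_nat1 expr0n mulr0 mul0r. Qed.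

Lemma stirling_small (n i : nat) : (n < i)%N -> signed_stirling n i = 0 :> F.
Proof.
elim: n i => [|n IHn] [|i] //= lt_ni; first exact: stirling0.
by rewrite stirling_recurrence !IHn ?mulr0 ?subrr // ltnW.
Qed.

Lemma exprN_rising (n : nat) (x : F) :
  (- x) ^+ n = \sum_(0 <= i < n.+1) signed_stirling n i * rising x i.
Proof.
elim: n => [|n IHn].
  rewrite big_nat1 /signed_stirling big_nat1 /rising big_geq //.
  by rewrite !expr0 !mulr1 invr1 mulr1.
rewrite exprS IHn mulr_sumr [RHS]big_nat_recl // stirlingS0 mul0r add0r.
under [RHS]eq_bigr => i _ do rewrite stirling_recurrence mulrBl.
rewrite sumrB.
(* Shifting the index of the first sum adds a zero term at i = 0 and drops the
   one at i = n+1, where the coefficient vanishes. *)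
have -> : \sum_(0 <= i < n.+1) i.+1%:R * signed_stirling n i.+1 * rising x i.+1
        = \sum_(0 <= i < n.+1) i%:R * signed_stirling n i * rising x i.
  rewrite big_nat_recr //= (stirling_small (ltnSn n)) mulr0 mul0r addr0.
  by rewrite [RHS]big_nat_recl // !mul0r add0r.
by rewrite -sumrB; apply: eq_bigr => i _; rewrite risingS; ring.
Qed.

End SignedStirling.

Lemma aE (n i : nat) :
  (0 < n)%N -> a n i = signed_stirling n i / i.+1%:R.
Proof.
case: n => // n _.
rewrite /a natr1 mul1r mulrC /signed_stirling [in RHS]big_nat_recl //.
rewrite expr0n mulr0 mul0r add0r; congr (_ * _).
by rewrite big_add1.
Qed.

Theorem theorem2p4 (n m : nat) (hn : (1 <= n)%N) (hm : (1 <= m)%N) :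
  \sum_(1 <= x < m.+1) (x%:R : rat) ^+ n =
  (-1) ^+ n * \sum_(1 <= i < n.+1) a n i * \prod_(0 <= j < i.+1) (m%:R + j%:R).
Proof.
have coef0 : signed_stirling n 0 = 0 :> rat.
  by case: n hn => // n' _; apply: stirlingS0.
have expand (x : nat) : (x%:R : rat) ^+ n =
    (-1) ^+ n * \sum_(1 <= i < n.+1) signed_stirling n i * rising x%:R i.
  have -> : x%:R ^+ n = (-1) ^+ n * (- x%:R) ^+ n :> rat.
    by rewrite -exprMn mulN1r opprK.
  rewrite [(- x%:R) ^+ n]exprN_rising; congr (_ * _).
  by rewrite big_nat_recl // coef0 mul0r add0r big_add1.
under eq_bigr => x _ do rewrite expand.
rewrite -mulr_sumr exchange_big /=; congr (_ * _).
apply: eq_bigr => i _.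
rewrite -/(rising (m%:R : rat) i.+1) -(sum_rising _ m i) aE //.
by rewrite mulrA divfK ?pnatr_eq0 // mulr_sumr.
Qed.
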